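(* Let $R$ be a ring and let $(P,Q,\psi)$ be an $R$-system. For $k\in\mathbb{Z}$ let $\mathcal{T}_{(P,Q,\psi)}^{(k)}=\bigoplus_{(m,n)\in\mathbb{N}_0^2,\ m-n=k}\mathcal{T}_{(m,n)}$. Then $\bigoplus_{n\in\mathbb{Z}}\mathcal{T}_{(P,Q,\psi)}^{(n)}$ is a $\mathbb{Z}$-grading of $\mathcal{T}_{(P,Q,\psi)}$. Moreover, it is the only $\mathbb{Z}$-grading $\bigoplus_{n\in\mathbb{Z}}\mathcal{Y}^{(n)}$ of $\mathcal{T}_{(P,Q,\psi)}$ for which $\iota_R(R)\subseteq\mathcal{Y}^{(0)}$, $\iota_Q(Q)\subseteq\mathcal{Y}^{(1)}$ and $\iota_P(P)\subseteq\mathcal{Y}^{(-1)}$.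
   Context: Rings are associative, not necessarily unital. For $R$-bimodules $P,Q$, $P\otimes Q$ is the $R$-balanced tensor product. ''Linear'' means additive and ''span'' means additive span. $\mathbb{N}=\{1,2,\dots\}$, $\mathbb{N}_0=\mathbb{N}\cup\{0\}$. An $R$-system is a triple $(P,Q,\psi)$ where $P,Q$ are $R$-bimodules and $\psi:P\otimes Q\to R$ is an $R$-bimodule homomorphism. A covariant representation of $(P,Q,\psi)$ is a quadruple $(S,T,\sigma,B)$ where $B$ is a ring, $S:P\to B$ and $T:Q\to B$ are linear maps, $\sigma:R\to B$ is a ring homomorphism, and $S(pr)=S(p)\sigma(r)$, $S(rp)=\sigma(r)S(p)$, $T(qr)=T(q)\sigma(r)$, $T(rq)=\sigma(r)T(q)$, $\sigma(\psi(p\otimes q))=S(p)T(q)$ for all $r\in R,p\in P,q\in Q$. It is surjective if $B$ is generated as a ring by $\sigma(R)\cup T(Q)\cup S(P)$, and injective if $\sigma$ is injective. The Toeplitz representation $(\iota_P,\iota_Q,\iota_R,\mathcal{T}_{(P,Q,\psi)})$ is the (up to isomorphism unique) surjective covariant representation such that for every covariant representation $(S,T,\sigma,B)$ there is a unique ring homomorphism $\eta_{(S,T,\sigma,B)}:\mathcal{T}_{(P,Q,\psi)}\to B$ with $\eta_{(S,T,\sigma,B)}\circ\iota_R=\sigma$, $\eta_{(S,T,\sigma,B)}\circ\iota_Q=T$, $\eta_{(S,T,\sigma,B)}\circ\iota_P=S$; it exists and is injective. For $n\ge 1$, $\iota_Q^n:Q^{\otimes n}\to\mathcal{T}_{(P,Q,\psi)}$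 and $\iota_P^n:P^{\otimes n}\to\mathcal{T}_{(P,Q,\psi)}$ are the linear maps with $\iota_Q^n(q_1\otimes\cdots\otimes q_n)=\iota_Q(q_1)\cdots\iota_Q(q_n)$ and $\iota_P^n(p_1\otimes\cdots\otimes p_n)=\iota_P(p_1)\cdots\iota_P(p_n)$. Put $\mathcal{T}_{(0,0)}=\iota_R(R)$, $\mathcal{T}_{(k,0)}=\iota_Q^k(Q^{\otimes k})$, $\mathcal{T}_{(0,k)}=\iota_P^k(P^{\otimes k})$ and $\mathcal{T}_{(m,n)}=\operatorname{span}\{\iota_Q^m(q)\iota_P^n(p)\mid q\in Q^{\otimes m},p\in P^{\otimes n}\}$ for $k,m,n\in\mathbb{N}$. Then $\mathcal{T}_{(P,Q,\psi)}=\bigoplus_{(m,n)\in\mathbb{N}_0^2}\mathcal{T}_{(m,n)}$ as an additive group, and this is a grading by the semigroup $\mathbb{N}_0^2$ with multiplication $(m,n)(k,l)=(m,n-k+l)$ if $n\ge k$ and $(m+k-n,l)$ if $k\ge n$. *)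

(* Defs.v *)
From HB Require Import structures.
From mathcomp Require Import all_boot all_order all_algebra.
From mathcomp Require Import generic_quotient ring_quotient.
From mathcomp Require Import boolp classical_sets cardinality fsbigop.
From mathcomp.multinomials Require Import freeg.

Set Implicit Arguments.
Unset Strict Implicit.
Unset Printing Implicit Defensive.

Import GRing.Theory.

Declare Scope rng_scope.
Local Open Scope classical_set_scope.
Local Open Scope quotient_scope.
Local Open Scope ring_scope.
Local Open Scope rng_scope.

(* Associative rings, not necessarily unital.  The ring structures of MathComp
   all carry a unit, hence this structure on top of zmodType. *)
HB.mixin Record isRng (R : Type) of GRing.Zmodule R := {
  rng_mul : R -> R -> R;
  rng_mulA : associative rng_mul;
  rng_mulDl : left_distributive rng_mul +%R;
  rng_mulDr : right_distributive rng_mul +%R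
}.

#[short(type="rngType")]
HB.structure Definition Rng := {R of isRng R & GRing.Zmodule R}.

Notation "x * y" := (rng_mul x y) : rng_scope.

HB.mixin Record isRngMultiplicative (A B : rngType) (f : A -> B) := {
  rng_morphM : {morph f : x y / x * y}
}.

#[short(type="rngMorphism")]
HB.structure Definition RngMorphism (A B : rngType) :=
  {f of isRngMultiplicative A B f & @GRing.Additive A B f}.

HB.mixin Record isBimodule (R : rngType) (M : Type) of GRing.Zmodule M := {
  lact : R -> M -> M;
  ract : M -> R -> M;
  lactDl : forall m r s, lact (r + s) m = lact r m + lact s m;
  lactDr : forall r m n, lact r (m + n) = lact r m + lact r n;
  lactM : forall r s m, lact (r * s) m = lact r (lact s m);
  ractDl : forall r m n, ract (m + n) r = ract m r + ract n r;
  ractDr : forall m r s, ract m (r + s) = ract m r + ract m s;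
  ractM : forall m r s, ract m (r * s) = ract (ract m r) s;
  lractA : forall r m s, ract (lact r m) s = lact r (ract m s)
}.

#[short(type="bimodType")]
HB.structure Definition Bimodule (R : rngType) :=
  {M of isBimodule R M & GRing.Zmodule M}.

Notation "r *< m" := (lact r m) (at level 40, left associativity) : rng_scope.
Notation "m >* r" := (ract m r) (at level 40, left associativity) : rng_scope.

Section Subsets.

Variable V : zmodType.

Definition subgroup (A : set V) : Prop :=
  A 0 /\ forall x y, A x -> A y -> A (x - y).

Definition addspan (A : set V) : set V := smallest subgroup A.

Lemma subgroup_addspan A : subgroup (addspan A).
Proof.
split=> [B [[B0 _] _] //|x y Ax Ay B BP].
by case: (BP) => [[_ BB] _]; apply: BB; [apply: Ax | apply: Ay].
Qed.

Lemma sub_addspan A : A `<=` addspan A.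
Proof. exact: sub_gen_smallest. Qed.

(* The sum of the subgroups A i, for i in D, i.e. the underlying set of their
   internal direct sum when they are independent. *)
Definition sum_subgroups (I : choiceType) (D : set I) (A : I -> set V) : set V :=
  [set x | exists f : I -> V,
     [/\ forall i, D i -> A i (f i),
         finite_set [set i | D i /\ f i <> 0]
       & x = \sum_(i \in D) f i]].

Definition is_direct_sum (I : choiceType) (A : I -> set V) : Prop :=
  (forall i, subgroup (A i)) /\
  forall x, exists! f : I -> V,
    [/\ forall i, A i (f i),
        finite_set [set i | f i <> 0]
      & x = \sum_(i \in [set: I]) f i].

End Subsets.

Definition subrng (B : rngType) (A : set B) : Prop :=
  subgroup A /\ forall x y, A x -> A y -> A (x * y).

Definition is_Zgrading (B : rngType) (Y : int -> set B) : Prop :=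
  is_direct_sum Y /\ forall m n x y, Y m x -> Y n y -> Y (m + n) (x * y).

Section Tensor.

Variables (R : rngType) (P Q : bimodType R).

Definition balanced (A : zmodType) (f : P -> Q -> A) : Prop :=
  [/\ forall q, zmod_morphism (f^~ q),
      forall p, zmod_morphism (f p)
    & forall p r q, f (p >* r) q = f p (r *< q)].

(* The R-balanced tensor product is the free abelian group on P * Q modulo the
   subgroup generated by tensor_rels. *)
Definition tensor_rels : set {freeg (P * Q)} :=
  [set x | exists p p' q, x = << (p + p', q) >> - << (p, q) >> - << (p', q) >>]
  `|` [set x | exists p q q', x = << (p, q + q') >> - << (p, q) >> - << (p, q') >>]
  `|` [set x | exists p r q, x = << (p >* r, q) >> - << (p, r *< q) >>].

Definition tensor_ker : pred {freeg (P * Q)} := fun x => `[< addspan tensor_rels x >].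

Lemma tensor_ker_zmod_closed : zmod_closed tensor_ker.
Proof.
have [K0 KB] := subgroup_addspan tensor_rels.
split=> [|x y]; rewrite !unfold_in; first exact: asboolT K0.
by move=> /asboolW Kx /asboolW Ky; exact: asboolT (KB _ _ Kx Ky).
Qed.

HB.instance Definition _ :=
  GRing.isZmodClosed.Build {freeg (P * Q)} tensor_ker tensor_ker_zmod_closed.

Definition tensor_kerZ : zmodClosed {freeg (P * Q)} :=
  GRing.ZmodClosed.clone _ tensor_ker _.

Definition tensor : Type := Quotient.quot tensor_kerZ.
HB.instance Definition _ := GRing.Zmodule.on tensor.

Definition tensor_pi (x : {freeg (P * Q)}) : tensor :=
  \pi_(Quotient.quot tensor_kerZ) x.

Definition tens (p : P) (q : Q) : tensor := tensor_pi << (p, q) >>.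

Lemma tensor_pi_additive : zmod_morphism tensor_pi.
Proof. exact: pi_is_zmod_morphism. Qed.
HB.instance Definition _ :=
  GRing.isZmodMorphism.Build _ _ tensor_pi tensor_pi_additive.

Lemma tensor_pi_eq x y :
  tensor_pi x = tensor_pi y <-> addspan tensor_rels (x - y).
Proof.
have -> : addspan tensor_rels (x - y) = ((x - y) \in tensor_ker).
  by rewrite unfold_in /tensor_ker asboolE.
by rewrite Quotient.idealrBE; split=> [?|/eqP]; [apply/eqP|].
Qed.

Lemma tensDl p p' q : tens (p + p') q = tens p q + tens p' q.
Proof.
rewrite -raddfD; apply/tensor_pi_eq; apply: sub_addspan; left; left.
by exists p, p', q; rewrite opprD addrA.
Qed.

Lemma tensDr p q q' : tens p (q + q') = tens p q + tens p q'.
Proof.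
rewrite -raddfD; apply/tensor_pi_eq; apply: sub_addspan; left; right.
by exists p, q, q'; rewrite opprD addrA.
Qed.

Lemma tensA p r q : tens (p >* r) q = tens p (r *< q).
Proof. by apply/tensor_pi_eq; apply: sub_addspan; right; exists p, r, q. Qed.

Lemma tens_balanced : balanced tens.
Proof.
split=> [q x y /=|p x y /=|p r q]; last exact: tensA.
- by apply/eqP; rewrite eq_sym subr_eq -tensDl subrK.
- by apply/eqP; rewrite eq_sym subr_eq -tensDr subrK.
Qed.

Lemma tensor_surj t : exists x, t = tensor_pi x.
Proof.
by exists (repr (t : (Quotient.quot tensor_kerZ))); rewrite /tensor_pi reprK.
Qed.

Section Lift.

Variables (A : zmodType) (f : P -> Q -> A).

Definition freeg_lift : {freeg (P * Q)} -> A :=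
  fglift (fun pq => f pq.1 pq.2 : zmodule A).

Lemma freeg_lift_additive : zmod_morphism freeg_lift.
Proof. exact: (@lift_is_additive int _ (zmodule A)). Qed.
HB.instance Definition _ :=
  GRing.isZmodMorphism.Build _ _ freeg_lift freeg_lift_additive.

Lemma freeg_liftE p q : freeg_lift << (p, q) >> = f p q.
Proof. by rewrite /freeg_lift liftU scale1r. Qed.

(* The additive map p (x) q |-> f p q; only meaningful for balanced f, see
   tensor_lift_additive and tensor_liftE. *)
Definition tensor_lift (t : tensor) : A :=
  freeg_lift (repr (t : (Quotient.quot tensor_kerZ))).

Hypothesis f_bal : balanced f.

Lemma tensor_lift_pi x : tensor_lift (tensor_pi x) = freeg_lift x.
Proof.
case: f_bal => fl fr fm; apply/eqP; rewrite -subr_eq0 -raddfB; apply/eqP.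
set y := repr _; have : addspan tensor_rels (y - x).
  by apply/tensor_pi_eq; rewrite /tensor_pi /y reprK.
pose K := [set z | freeg_lift z = 0]; rewrite -[_ = 0]/(K _).
apply; split.
  split; first exact: raddf0.
  by move=> u v; rewrite /K /= => u0 v0; rewrite raddfB /= u0 v0 subr0.
move=> z [[|]|]; rewrite /K /=.
- move=> [p [p' [q ->]]]; rewrite !raddfB /= !freeg_liftE.
  have := fl q (p + p') p'; rewrite /= addrK => ->.
  by rewrite opprB addrCA subrr addr0 subrr.
- move=> [p [q [q' ->]]]; rewrite !raddfB /= !freeg_liftE.
  have := fr p (q + q') q'; rewrite addrK => ->.
  by rewrite opprB addrCA subrr addr0 subrr.
- by move=> [p [r [q ->]]]; rewrite raddfB /= !freeg_liftE fm subrr.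
Qed.

Lemma tensor_liftE p q : tensor_lift (tens p q) = f p q.
Proof. by rewrite tensor_lift_pi freeg_liftE. Qed.

Lemma tensor_lift_additive : zmod_morphism tensor_lift.
Proof.
move=> s t; have [x ->] := tensor_surj s; have [y ->] := tensor_surj t.
by rewrite -raddfB !tensor_lift_pi raddfB.
Qed.

End Lift.

Lemma tensor_ext (A : zmodType) (g h : tensor -> A) :
  zmod_morphism g -> zmod_morphism h ->
  (forall p q, g (tens p q) = h (tens p q)) -> g =1 h.
Proof.
move=> gA hA gh t; have [x ->] := tensor_surj t.
pose gM := HB.pack_for {additive tensor -> A} g (GRing.isZmodMorphism.Build _ _ g gA).
pose hM := HB.pack_for {additive tensor -> A} h (GRing.isZmodMorphism.Build _ _ h hA).
rewrite -[g]/(gM : _ -> _) -[h]/(hM : _ -> _).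
elim/freeg_ind_dom0: x => [|k [p q] x _ _ IH]; first by rewrite !raddf0.
have {}IH : g (tensor_pi x) = h (tensor_pi x) := IH.
rewrite !raddfD /= IH; congr (_ + _).
have -> : << k *g (p, q) >> = << (p, q) >> *~ k :> {freeg (P * Q)}.
  by rewrite freegU_mulz intz.
rewrite raddfMz /= -[tensor_pi << _ >>]/(tens p q).
have -> : g (tens p q *~ k) = g (tens p q) *~ k := raddfMz gM k _.
have -> : h (tens p q *~ k) = h (tens p q) *~ k := raddfMz hM k _.
by rewrite gh.
Qed.

End Tensor.

Arguments tensor {R} P Q.

Section TensorBimodule.

Variables (R : rngType) (P Q : bimodType R).
Implicit Types (r s : R) (t : tensor P Q).

Definition tensor_lact r : tensor P Q -> tensor P Q :=
  tensor_lift (fun p q => tens (r *< p) q).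

Definition tensor_ract t r : tensor P Q :=
  tensor_lift (fun p q => tens p (q >* r)) t.

Lemma zmod_morphismD (U V : zmodType) (f : U -> V) :
  {morph f : x y / x + y} -> zmod_morphism f.
Proof.
by move=> fD x y; apply/eqP; rewrite eq_sym subr_eq -fD subrK.
Qed.

Lemma zmod_morphism_add (U V : zmodType) (f : U -> V) :
  zmod_morphism f -> {morph f : x y / x + y}.
Proof.
by move=> fB x y; apply/eqP; rewrite -subr_eq -fB addrK.
Qed.

Lemma lact_balanced r : balanced (fun p (q : Q) => tens (r *< p : P) q).
Proof.
split=> [q|p|p s q].
- by apply: zmod_morphismD => x y /=; rewrite lactDr tensDl.
- by apply: zmod_morphismD => x y /=; rewrite tensDr.
- by rewrite -lractA tensA.
Qed.

Lemma ract_balanced r : balanced (fun (p : P) q => tens p (q >* r : Q)).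
Proof.
split=> [q|p|p s q].
- by apply: zmod_morphismD => x y /=; rewrite tensDl.
- by apply: zmod_morphismD => x y /=; rewrite ractDl tensDr.
- by rewrite tensA lractA.
Qed.

Lemma tensor_lact_tens r p q : tensor_lact r (tens p q) = tens (r *< p) q.
Proof. exact: tensor_liftE (lact_balanced r) p q. Qed.

Lemma tensor_ract_tens r p q : tensor_ract (tens p q) r = tens p (q >* r).
Proof. exact: tensor_liftE (ract_balanced r) p q. Qed.

Lemma tensor_lact_additive r : zmod_morphism (tensor_lact r).
Proof. exact: tensor_lift_additive (lact_balanced r). Qed.

Lemma tensor_ract_additive r : zmod_morphism (tensor_ract^~ r).
Proof. exact: tensor_lift_additive (ract_balanced r). Qed.

Lemma zmod_morphism_addf (U V : zmodType) (f g : U -> V) :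
  zmod_morphism f -> zmod_morphism g -> zmod_morphism (fun x => f x + g x).
Proof. by move=> fB gB x y; rewrite fB gB opprD addrACA. Qed.

Lemma zmod_morphism_comp (U V W : zmodType) (f : V -> W) (g : U -> V) :
  zmod_morphism f -> zmod_morphism g -> zmod_morphism (fun x => f (g x)).
Proof. by move=> fB gB x y; rewrite gB fB. Qed.

Lemma tensor_lactDl t r s :
  tensor_lact (r + s) t = tensor_lact r t + tensor_lact s t.
Proof.
move: t; apply: tensor_ext => [||p q].
- exact: tensor_lact_additive.
- by apply: zmod_morphism_addf; exact: tensor_lact_additive.
- by rewrite !tensor_lact_tens lactDl tensDl.
Qed.

Lemma tensor_lactDr r : {morph tensor_lact r : s t / s + t}.
Proof. exact/zmod_morphism_add/tensor_lact_additive. Qed.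

Lemma tensor_lactM r s t :
  tensor_lact (r * s) t = tensor_lact r (tensor_lact s t).
Proof.
move: t; apply: tensor_ext => [||p q].
- exact: tensor_lact_additive.
- by apply: zmod_morphism_comp; exact: tensor_lact_additive.
- by rewrite !tensor_lact_tens lactM.
Qed.

Lemma tensor_ractDl r : {morph tensor_ract^~ r : s t / s + t}.
Proof. exact/zmod_morphism_add/tensor_ract_additive. Qed.

Lemma tensor_ractDr t r s :
  tensor_ract t (r + s) = tensor_ract t r + tensor_ract t s.
Proof.
move: t; apply: tensor_ext => [||p q].
- exact: tensor_ract_additive.
- by apply: zmod_morphism_addf; exact: tensor_ract_additive.
- by rewrite !tensor_ract_tens ractDr tensDr.
Qed.

Lemma tensor_ractM t r s :
  tensor_ract t (r * s) = tensor_ract (tensor_ract t r) s.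
Proof.
move: t; apply: tensor_ext => [||p q].
- exact: tensor_ract_additive.
- by apply: (zmod_morphism_comp (f := tensor_ract^~ s));
    exact: tensor_ract_additive.
- by rewrite !tensor_ract_tens ractM.
Qed.

Lemma tensor_lractA r t s :
  tensor_ract (tensor_lact r t) s = tensor_lact r (tensor_ract t s).
Proof.
move: t; apply: tensor_ext => [||p q].
- apply: (zmod_morphism_comp (f := tensor_ract^~ s)).
    exact: tensor_ract_additive.
  exact: tensor_lact_additive.
- apply: zmod_morphism_comp; first exact: tensor_lact_additive.
  exact: tensor_ract_additive.
- by rewrite tensor_lact_tens !tensor_ract_tens tensor_lact_tens.
Qed.

HB.instance Definition _ := isBimodule.Build R (tensor P Q)
  tensor_lactDl tensor_lactDr tensor_lactM
  tensor_ractDl tensor_ractDr tensor_ractM tensor_lractA.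

Lemma lact_tens r (p : P) (q : Q) : r *< tens p q = tens (r *< p) q.
Proof. exact: tensor_lact_tens. Qed.

Lemma ract_tens r (p : P) (q : Q) : tens p q >* r = tens p (q >* r).
Proof. exact: tensor_ract_tens. Qed.

End TensorBimodule.

Notation "P ⊗ Q" := (tensor P Q) (at level 40, left associativity) : type_scope.

Section TensorPower.

Variables (R : rngType) (M : bimodType R).

(* tpow n is the (n+1)-fold tensor power of M; the zeroth power is left out. *)
Fixpoint tpow (n : nat) : bimodType R :=
  if n is n'.+1 then (M ⊗ tpow n')%type : bimodType R else M.

Variables (B : rngType) (f : M -> B).

(* The additive map m_0 (x) ... (x) m_n |-> f m_0 * ... * f m_n on tpow n.  It
   is well defined as soon as f is additive and compatible with the actions,
   see tpow_lift_additive and tpow_liftS. *)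
Fixpoint tpow_lift (n : nat) : tpow n -> B :=
  if n is n'.+1 return tpow n -> B
  then tensor_lift (fun m (t : tpow n') => f m * tpow_lift t) else f.

Variable sigma : R -> B.
Hypothesis f_additive : zmod_morphism f.
Hypothesis f_lact : forall r m, f (r *< m) = sigma r * f m.
Hypothesis f_ract : forall m r, f (m >* r) = f m * sigma r.

Lemma rng_mul_additivel (y : B) : zmod_morphism (fun x => x * y).
Proof. by apply: zmod_morphismD => u v; rewrite rng_mulDl. Qed.

Lemma rng_mul_additiver (x : B) : zmod_morphism (rng_mul x).
Proof. by apply: zmod_morphismD => u v; rewrite rng_mulDr. Qed.

Lemma tpow_lift_rec n :
  [/\ zmod_morphism (@tpow_lift n),
      forall r t, tpow_lift (r *< t : tpow n) = sigma r * tpow_lift t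
    & balanced (fun m (t : tpow n) => f m * tpow_lift t)].
Proof.
have bal k : zmod_morphism (@tpow_lift k) ->
    (forall r t, tpow_lift (r *< t : tpow k) = sigma r * tpow_lift t) ->
    balanced (fun m (t : tpow k) => f m * tpow_lift t).
  move=> FB Fl; split=> [t|m|m r t].
  - exact: zmod_morphism_comp (rng_mul_additivel _) f_additive.
  - exact: zmod_morphism_comp (rng_mul_additiver _) FB.
  - by rewrite f_ract Fl rng_mulA.
elim: n => [|n [FB Fl Fbal]].
  by split=> //; exact: bal.
have FB' : zmod_morphism (@tpow_lift n.+1) by exact: tensor_lift_additive.
suff Fl' r (t : tpow n.+1) : tpow_lift (r *< t) = sigma r * tpow_lift t.
  by split=> //; exact: bal.
move: t; apply: tensor_ext => [||m t].
- apply: (zmod_morphism_comp (f := @tpow_lift n.+1)) => //.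
  exact: tensor_lact_additive.
- exact: zmod_morphism_comp (rng_mul_additiver _) FB'.
- by rewrite [lact _ _]lact_tens /= !tensor_liftE // f_lact rng_mulA.
Qed.

Lemma tpow_lift_additive n : zmod_morphism (@tpow_lift n).
Proof. by case: (tpow_lift_rec n). Qed.

Lemma tpow_liftS n m (t : tpow n) :
  tpow_lift (tens m t : tpow n.+1) = f m * tpow_lift t.
Proof. by case: (tpow_lift_rec n) => _ _ /tensor_liftE; exact. Qed.

End TensorPower.

Record rsystem (R : rngType) := RSystem {
  sysP : bimodType R;
  sysQ : bimodType R;
  psi : {additive sysP ⊗ sysQ -> R};
  psi_lact : forall r t, psi (r *< t) = r * psi t;
  psi_ract : forall t r, psi (t >* r) = psi t * r
}.

Section Toeplitz.

Variables (R : rngType) (X : rsystem R).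
Local Notation P := (sysP X).
Local Notation Q := (sysQ X).

Record covariant_rep (B : rngType) := CovariantRep {
  rep_P : {additive P -> B};
  rep_Q : {additive Q -> B};
  rep_R : rngMorphism R B;
  rep_P_ract : forall p r, rep_P (p >* r) = rep_P p * rep_R r;
  rep_P_lact : forall r p, rep_P (r *< p) = rep_R r * rep_P p;
  rep_Q_ract : forall q r, rep_Q (q >* r) = rep_Q q * rep_R r;
  rep_Q_lact : forall r q, rep_Q (r *< q) = rep_R r * rep_Q q;
  rep_psi : forall p q, rep_R (psi X (tens p q)) = rep_P p * rep_Q q
}.

Definition is_surjective_rep (B : rngType) (c : covariant_rep B) : Prop :=
  smallest (@subrng B)
    (range (rep_R c) `|` range (rep_Q c) `|` range (rep_P c)) = [set: B].

Definition factors_through (T B : rngType) (iota : covariant_rep T)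
    (c : covariant_rep B) (eta : rngMorphism T B) : Prop :=
  [/\ eta \o rep_R iota =1 rep_R c,
      eta \o rep_Q iota =1 rep_Q c
    & eta \o rep_P iota =1 rep_P c].

Definition is_toeplitz (T : rngType) (iota : covariant_rep T) : Prop :=
  is_surjective_rep iota /\
  forall (B : rngType) (c : covariant_rep B),
    exists2 eta : rngMorphism T B, factors_through iota c eta &
      forall eta', factors_through iota c eta' -> eta' =1 eta.

Variables (T : rngType) (iota : covariant_rep T).

(* Recall the index shift of tpow: tpow Q k is the (k+1)-fold tensor power. *)
Definition toeplitz_bipart (m n : nat) : set T :=
  match m, n with
  | 0, 0 => range (rep_R iota)
  | k.+1, 0 => range (@tpow_lift R Q T (rep_Q iota) k)
  | 0, k.+1 => range (@tpow_lift R P T (rep_P iota) k)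
  | m'.+1, n'.+1 =>
      addspan [set x | exists (q : tpow Q m') (p : tpow P n'),
                 x = tpow_lift (rep_Q iota) q * tpow_lift (rep_P iota) p]
  end.

Definition toeplitz_part (k : int) : set T :=
  sum_subgroups [set mn : nat * nat | Posz mn.1 - Posz mn.2 = k]
    (fun mn => toeplitz_bipart mn.1 mn.2).

End Toeplitz.

(* Main.v *)
(** Independence of the parts comes from the universal property: the assignment
    r |-> r, q |-> q t, p |-> p t^-1 is a covariant representation in the Laurent
    polynomials over the Toeplitz ring, and the induced morphism sends x to
    x t^k when x lies in the part of degree k, so the coefficients of the image
    of a sum recover its components.  Laurent polynomials are replaced by the
    additive endomorphisms of the sequences indexed by int with values in the
    unitization of the ring.  The parts are the smallest graded family
    containing the generators in the prescribed degrees, so they are contained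
    in those of any other such grading; two direct sum decompositions that are
    comparable in this way coincide. *)
Require Import Defs.
From HB Require Import structures.
From mathcomp Require Import all_boot all_order all_algebra finmap.
From mathcomp Require Import boolp classical_sets functions cardinality.
From mathcomp Require Import fsbigop.
From mathcomp.multinomials Require Import freeg.

Import GRing.Theory.

Local Open Scope classical_set_scope.
Local Open Scope ring_scope.

Lemma zmod_morphism0 {U V : zmodType} {f : U -> V} : zmod_morphism f -> f 0 = 0.
Proof. by move=> fB; have := fB 0 0; rewrite !subrr. Qed.

(** * Subgroups of an abelian group and internal direct sums *)

Section Subgroups.
Context {V : zmodType}.
Implicit Types A B : set V.

Lemma subgroupN A x : subgroup A -> A x -> A (- x).
Proof. by move=> [A0 AB] Ax; rewrite -sub0r; exact: AB. Qed.

Lemma subgroupD A x y : subgroup A -> A x -> A y -> A (x + y).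
Proof.
by move=> sA Ax Ay; rewrite -[y]opprK; apply: (proj2 sA) => //; exact: subgroupN.
Qed.

Lemma subgroup_preimage (U : zmodType) (f : U -> V) A :
  zmod_morphism f -> subgroup A -> subgroup (f @^-1` A).
Proof.
move=> fB [A0 AB]; split=> [|x y Ax Ay] /=; last by rewrite fB; exact: AB.
by rewrite /preimage /= zmod_morphism0.
Qed.

Lemma subgroup_range (U : zmodType) (f : U -> V) :
  zmod_morphism f -> subgroup (range f).
Proof.
move=> fB; split; last by move=> _ _ [x _ <-] [y _ <-]; exists (x - y); rewrite ?fB.
by exists 0 => //; exact: zmod_morphism0.
Qed.

Lemma addspan_min A B : subgroup B -> A `<=` B -> addspan A `<=` B.
Proof. by move=> sB AB; apply: smallest_sub. Qed.

Section Sums.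
Context {I : choiceType}.
Implicit Types (D : set I) (f : I -> V).

Lemma subgroup_fsum B D f :
  subgroup B -> (forall i, D i -> B (f i)) -> B (\sum_(i \in D) f i).
Proof.
move=> sB Bf; rewrite big_seq; elim/big_ind: _ => [|x y|i].
- exact: (proj1 sB).
- exact: subgroupD.
- by case: finite_supportP => //= X XD _ _ /XD /Bf.
Qed.

Lemma sum_subgroups_min D (A : I -> set V) B :
  subgroup B -> (forall i, D i -> A i `<=` B) -> sum_subgroups D A `<=` B.
Proof.
by move=> sB AB _ [f [Af _ ->]]; apply: subgroup_fsum => // i Di; exact/AB/Af.
Qed.

Lemma fsum_single D i x : D i ->
  finite_set [set j | D j /\ (if j == i then x else 0) <> 0 :> V] /\
  \sum_(j \in D) (if j == i then x else 0) = x.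
Proof.
move=> Di; split.
  apply: (sub_finite_set _ (finite_set1 i)) => j [_] /=.
  by case: eqP.
rewrite -(fsbig_widen [set i] D) ?fsbig_set1 ?eqxx //=.
- by move=> j ->.
- by move=> j [_] /= /eqP/negPf ->.
Qed.

Lemma sub_sum_subgroups D (A : I -> set V) i :
  (forall i, D i -> subgroup (A i)) -> D i -> A i `<=` sum_subgroups D A.
Proof.
move=> sA Di x Ax; exists (fun j => if j == i then x else 0).
have [fin ->] := fsum_single D i x Di; split=> // j Dj.
by case: eqP => [->//|_]; case: (sA j Dj).
Qed.

Lemma subgroup_sum D (A : I -> set V) :
  (forall i, D i -> subgroup (A i)) -> subgroup (sum_subgroups D A).
Proof.
move=> sA; split.
  exists (fun=> 0); split=> [i /sA[]//||].
    by apply: (sub_finite_set _ (finite_set0 I)) => i [].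
  by rewrite fsbig1.
move=> _ _ [f [Af ff ->]] [g [Ag fg ->]]; exists (fun i => f i - g i).
have fU : finite_set ([set i | D i /\ f i <> 0] `|` [set i | D i /\ g i <> 0]).
  by rewrite finite_setU.
split=> [i Di||].
- by apply: (proj2 (sA i Di)); [exact: Af | exact: Ag].
- apply: (sub_finite_set _ fU) => i [Di] /=.
  have [->|/eqP f0 _] := eqVneq (f i) 0; last by left.
  by rewrite sub0r => g0; right; split=> // gi0; apply: g0; rewrite gi0 oppr0.
(* The supports of [f], [g] and their difference may differ, so all three sums are taken over the
   union [r] of the first two. *)
set r := fset_set ([set i | D i /\ f i <> 0] `|` [set i | D i /\ g i <> 0]).
have rP i : (i \in r) = ((D i /\ f i <> 0) \/ (D i /\ g i <> 0)) :> Prop.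
  by rewrite /r in_fset_set // inE.
have rD : [set` r] `<=` D by move=> i /=; rewrite rP; case=> [][].
have r0 i : D i -> i \notin r -> f i = 0 /\ g i = 0.
  move=> Di /negP; rewrite rP => /not_orP[nf ng].
  by split; apply: contrapT => h; [apply: nf | apply: ng].
rewrite !(fsbigE r) ?fset_uniq //.
- by rewrite -sumrB.
- by move=> i Di /r0[] // -> ->; rewrite subrr.
- by move=> i Di /r0[].
- by move=> i Di /r0[].
Qed.

Lemma direct_sum_eq (A : I -> set V) (f g : I -> V) : is_direct_sum A ->
  (forall i, A i (f i)) -> finite_set [set i | f i <> 0] ->
  (forall i, A i (g i)) -> finite_set [set i | g i <> 0] ->
  \sum_(i \in [set: I]) f i = \sum_(i \in [set: I]) g i -> f = g.
Proof.
move=> [_ dA] Af ff Ag fg fgE; have [h [_ hu]] := dA (\sum_(i \in [set: I]) f i).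
by rewrite -(hu f) // (hu g).
Qed.

(** Each [c i] reads off the component of index [i] of any finite decomposition, which gives
    uniqueness; the last hypothesis gives existence. *)
Lemma direct_sum_proj (A : I -> set V) (c : I -> {additive V -> V}) :
  (forall i, subgroup (A i)) ->
  (forall i j x, A j x -> c i x = if j == i then x else 0) ->
  sum_subgroups [set: I] A = [set: V] ->
  is_direct_sum A.
Proof.
move=> sA cA AT; split=> // x; have : [set: V] x by [].
rewrite -AT => -[f [Af ff xE]]; exists f; split.
  by split=> //; [move=> i; exact: Af | apply: sub_finite_set ff].
have ev g i : (forall i, A i (g i)) -> finite_set [set i | g i <> 0] ->
    c i (\sum_(j \in [set: I]) g j) = g i.
  move=> Ag gf; rewrite fsbig_supp setTI.
  rewrite -[_ @^-1` _]/[set j | g j <> 0] fsbig_finite // raddf_sum.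
  rewrite (eq_bigr (fun j => if j == i then g j else 0)); last first.
    by move=> j _; exact: cA.
  have [ir|ir] := boolP (i \in fset_set [set j | g j <> 0]).
    rewrite (bigD1_seq i) ?fset_uniq //= eqxx big1 ?addr0 // => j.
    by move/negPf=> ->.
  rewrite big1_seq; last by move=> j /= jr; case: eqP ir jr => // <- /negPf ->.
  apply: contrapT => g0; move/negP: ir; apply.
  by rewrite in_fset_set // inE /=; apply/nesym.
move=> g [Ag gf xg]; apply/funext => i.
rewrite -(ev g) // -xg xE; apply/esym/ev => [j|]; first exact: Af.
by apply: sub_finite_set ff.
Qed.

(** For [x] in [A i], its decomposition along [B] is also one along [A], and so is [x] placed alone
    at index [i]. Uniqueness along [A] identifies the two, so [x] is its own [B]-component of index
    [i]. *)
Lemma direct_sum_sub (A B : I -> set V) :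
  is_direct_sum A -> is_direct_sum B -> (forall i, B i `<=` A i) -> A = B.
Proof.
move=> dA [sB dB] BA; apply/funext => i; apply/seteqP; split=> [x Ax|];
  last exact: BA.
have [f [[Bf ff xE] _]] := dB x.
have [fin sumE] := fsum_single [set: I] i x Logic.I.
suff -> : x = f i by [].
have <- : (fun j => if j == i then x else 0) = f.
  apply: (direct_sum_eq A) => // [j|||].
  - by case: eqP => [->//|_]; case: (proj1 dA j).
  - by apply: sub_finite_set fin.
  - by move=> j; exact/BA.
  - by rewrite sumE.
by rewrite eqxx.
Qed.

End Sums.
End Subgroups.

(** * The ring of additive endomorphisms of an abelian group *)

Section EndRing.
Variable V : zmodType.
Local Open Scope rng_scope.

Definition additive_pred : {pred V -> V} := fun f => `[< zmod_morphism f >].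

Lemma additive_predP f : reflect (zmod_morphism f) (f \in additive_pred).
Proof. exact: asboolP. Qed.

Lemma additive_pred_zmod_closed : zmod_closed additive_pred.
Proof.
split=> [|f g /additive_predP fB /additive_predP gB]; apply/additive_predP.
  by move=> x y /=; rewrite subrr.
by move=> x y; rewrite !fctE fB gB !opprD !opprK addrACA.
Qed.

HB.instance Definition _ :=
  GRing.isZmodClosed.Build (V -> V) additive_pred additive_pred_zmod_closed.

Record end_rng := EndRng {
  end_fun :> V -> V;
  end_funP : end_fun \in additive_pred
}.

HB.instance Definition _ := [isSub for end_fun].
HB.instance Definition _ := [Choice of end_rng by <:].
HB.instance Definition _ := [SubChoice_isSubZmodule of end_rng by <:].

Lemma end_additive (f : end_rng) : zmod_morphism f.
Proof. exact/additive_predP/end_funP. Qed.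

Lemma end_comp_subproof (f g : end_rng) : f \o g \in additive_pred.
Proof. by apply/additive_predP => x y; rewrite /= !end_additive. Qed.

Definition end_comp (f g : end_rng) : end_rng :=
  EndRng _ (end_comp_subproof f g).

Lemma end_compA : associative end_comp.
Proof. by move=> f g h; apply: val_inj. Qed.

Lemma end_compDl : left_distributive end_comp +%R.
Proof. by move=> f g h; apply: val_inj. Qed.

Lemma end_compDr : right_distributive end_comp +%R.
Proof.
move=> f g h; apply: val_inj; apply/funext => x.
exact: (zmod_morphism_add (end_additive f)).
Qed.

HB.instance Definition _ := isRng.Build end_rng end_compA end_compDl end_compDr.

End EndRing.

(** * Laurent monomials as shift operators on sequences *)

Section Shift.
Variable T : rngType.
Local Open Scope rng_scope.

(* Left multiplication by [x] on the unitization of [T]; unlike on [T] itself,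
   it determines [x]. *)
Definition unitize_lmul (x : T) (u : int * T) : int * T :=
  (0, x *~ u.1 + rng_mul x u.2).

Lemma unitize_lmulBr x : zmod_morphism (unitize_lmul x).
Proof.
move=> u v; rewrite /unitize_lmul; apply/pair_equal_spec; split=> /=.
  by rewrite subrr.
by rewrite mulrzBr rng_mul_additiver opprD addrACA.
Qed.

Lemma unitize_lmulBl u : zmod_morphism (unitize_lmul^~ u).
Proof.
move=> x y; rewrite /unitize_lmul; apply/pair_equal_spec; split=> /=.
  by rewrite subrr.
by rewrite mulrzBl rng_mul_additivel opprD addrACA.
Qed.

Lemma unitize_lmulM x y u :
  unitize_lmul (rng_mul x y) u = unitize_lmul x (unitize_lmul y u).
Proof.
rewrite /unitize_lmul /= mulr0z add0r rng_mulDr rng_mulA; congr (_, _ + _).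
(* Packed as an additive map, left multiplication by [x] commutes with integer multiples. *)
pose f := HB.pack_for {additive T -> T} (rng_mul x)
  (GRing.isZmodMorphism.Build _ _ _ (rng_mul_additiver x)).
exact: (esym (raddfMz f _ y)).
Qed.

(* Stands for [x t^k] in the Laurent polynomials over [T], acting on formal
   series over the unitization of [T]. *)
Definition shift_fun (k : int) (x : T) (g : int -> int * T) : int -> int * T :=
  fun i => unitize_lmul x (g (i - k)).

Lemma shift_subproof k x : shift_fun k x \in additive_pred (int -> int * T).
Proof.
by apply/additive_predP => g h; apply/funext => i; exact: unitize_lmulBr.
Qed.

Definition shift k x : end_rng (int -> int * T) :=
  EndRng _ _ (shift_subproof k x).

Lemma shift_additive k : zmod_morphism (shift k).
Proof.
move=> x y; apply: val_inj; apply/funext => g; apply/funext => i.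
exact: unitize_lmulBl.
Qed.

HB.instance Definition _ k :=
  GRing.isZmodMorphism.Build _ _ (shift k) (shift_additive k).

Lemma shiftM k l x y : shift k x * shift l y = shift (k + l) (x * y).
Proof.
apply: val_inj; apply/funext => g; apply/funext => i.
by rewrite /= /shift_fun /= unitize_lmulM opprD addrA.
Qed.

(* The [i]th coefficient of [f 1]. *)
Definition coef (i : int) (f : end_rng (int -> int * T)) : T :=
  (f (fun j => if j == 0 then (1, 0) else 0) i).2.

Lemma coef_additive i : zmod_morphism (coef i).
Proof. by []. Qed.

HB.instance Definition _ i :=
  GRing.isZmodMorphism.Build _ _ (coef i) (coef_additive i).

(** The test sequence is the unit at index 0; [shift k x] moves it to index [k], where it becomes
    [(0, x)]. *)
Lemma coef_shift i k x : coef i (shift k x) = if k == i then x else 0.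
Proof.
rewrite /coef /= /shift_fun subr_eq0 eq_sym; case: eqP => _ /=.
  by rewrite mulr1z (zmod_morphism0 (rng_mul_additiver x)) addr0.
by rewrite mulr0z (zmod_morphism0 (rng_mul_additiver x)) addr0.
Qed.

End Shift.

(** Tensors are integer combinations of pure tensors, and a subgroup is closed under these
    combinations. *)
Lemma tensor_ind (R : rngType) (P Q : bimodType R) (K : set (tensor P Q)) :
  subgroup K -> (forall p q, K (tens p q)) -> forall t, K t.
Proof.
move=> sK Kt t; have [x ->] := tensor_surj t.
elim/freeg_ind_dom0: x => [|k [p q] x _ _ IH].
  by rewrite raddf0; case: sK.
rewrite raddfD; apply: subgroupD => //.
have -> : << k *g (p, q) >> = << (p, q) >> *~ k :> {freeg (P * Q)}.
  by rewrite freegU_mulz intz.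
rewrite raddfMz /= -[tensor_pi _]/(tens p q).
have Kn n : K (tens p q *+ n).
  by elim: n => [|n IHn]; [case: sK | rewrite mulrS; exact: subgroupD].
by case: k => n; rewrite ?NegzE ?mulrNz; [|apply: subgroupN => //]; exact: Kn.
Qed.

(** * The parts attached to a covariant representation and their products *)

Section Toeplitz.
Variables (R : rngType) (X : rsystem R) (T : rngType) (iota : covariant_rep X T).
Local Notation P := (sysP X).
Local Notation Q := (sysQ X).
Local Notation iP := (rep_P iota).
Local Notation iQ := (rep_Q iota).
Local Notation iR := (rep_R iota).
Local Open Scope rng_scope.

(** Induction on the number of factors: the lift is additive, so [tensor_ind] reduces to pure
    tensors, where it is a product. The multiple of [d] is [n.+1] because [tpow M n] has [n.+1]
    factors. *)
Lemma tpow_lift_graded (M : bimodType R) (f : {additive M -> T})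
    (f_lact : forall r m, f (r *< m) = iR r * f m)
    (f_ract : forall m r, f (m >* r) = f m * iR r) (Y : int -> set T) (d : int) :
  (forall k, subgroup (Y k)) ->
  (forall k l x y, Y k x -> Y l y -> Y (k + l) (x * y)) ->
  range f `<=` Y d ->
  forall n (t : tpow M n), Y (d *+ n.+1) (tpow_lift f t).
Proof.
move=> sY YM fY; elim=> [|n IH]; first by move=> t; apply: fY; exists t.
have fB : zmod_morphism f := raddfB f.
apply: tensor_ind => [|m t].
  apply: subgroup_preimage => //.
  exact: (tpow_lift_additive fB f_lact f_ract (n := n.+1)).
have := YM _ _ _ _ (fY _ (imageT f m)) (IH t).
by rewrite -mulrS -(tpow_liftS fB f_lact f_ract).
Qed.

Let iPB : zmod_morphism iP := raddfB iP.
Let iQB : zmod_morphism iQ := raddfB iQ.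
Let iPl := rep_P_lact iota.
Let iPr := rep_P_ract iota.
Let iQl := rep_Q_lact iota.
Let iQr := rep_Q_ract iota.

Lemma subgroup_toeplitz_bipart m n : subgroup (toeplitz_bipart iota m n).
Proof.
case: m n => [|m] [|n] /=; last exact: subgroup_addspan.
- exact/subgroup_range/(raddfB iR).
- exact/subgroup_range/(tpow_lift_additive iPB iPl iPr).
- exact/subgroup_range/(tpow_lift_additive iQB iQl iQr).
Qed.

Lemma subgroup_toeplitz_part k : subgroup (toeplitz_part iota k).
Proof. by apply: subgroup_sum => i _; exact: subgroup_toeplitz_bipart. Qed.

Lemma sub_toeplitz_part m n (k : int) : m%:Z - n%:Z = k ->
  toeplitz_bipart iota m n `<=` toeplitz_part iota k.
Proof.
move=> mn; apply: (@sub_sum_subgroups _ _ _ _ (m, n)) => // i _.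
exact: subgroup_toeplitz_bipart.
Qed.

(** Up to sums, a nonscalar element of [toeplitz_bipart m n] is a product of [m] generators of
    degree 1 and [n] of degree -1. The family [Y] will be a competing grading, the left multipliers
    in [toeplitz_partM], or the elements on which a morphism acts as a shift. *)
Lemma toeplitz_part_min (Y : int -> set T) :
  (forall k, subgroup (Y k)) ->
  (forall k l x y, Y k x -> Y l y -> Y (k + l) (x * y)) ->
  range iR `<=` Y 0 -> range iQ `<=` Y 1 -> range iP `<=` Y (-1) ->
  forall n, toeplitz_part iota n `<=` Y n.
Proof.
move=> sY YM YR YQ YP k; apply: sum_subgroups_min => // -[m n] /= <- {k}.
have tQ m' (t : tpow Q m') : Y m'.+1%:Z (tpow_lift iQ t).
  by have := tpow_lift_graded _ _ iQl iQr _ _ sY YM YQ m' t; rewrite pmulrn intz.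
have tP n' (t : tpow P n') : Y (- n'.+1%:Z) (tpow_lift iP t).
  by have := tpow_lift_graded _ _ iPl iPr _ _ sY YM YP n' t; rewrite mulNrn pmulrn intz.
case: m n => [|m] [|n] /=.
- by rewrite subrr.
- by rewrite sub0r => _ [t _ <-].
- by rewrite subr0 => _ [t _ <-].
- by apply: addspan_min => // _ [q [p ->]]; exact: YM.
Qed.

(** The scalar is absorbed by the leftmost tensor factor through the left action. *)
Lemma lmulR_bipart m n r x :
  toeplitz_bipart iota m n x -> toeplitz_bipart iota m n (iR r * x).
Proof.
have lP n' (t : tpow P n') : iR r * tpow_lift iP t = tpow_lift iP (r *< t).
  by have [_ ->] := tpow_lift_rec iPB iPl iPr n'.
have lQ n' (t : tpow Q n') : iR r * tpow_lift iQ t = tpow_lift iQ (r *< t).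
  by have [_ ->] := tpow_lift_rec iQB iQl iQr n'.
case: m n => [|m] [|n] /=.
- by move=> [s _ <-]; exists (r * s) => //; rewrite rng_morphM.
- by move=> [t _ <-]; rewrite lP; exists (r *< t).
- by move=> [t _ <-]; rewrite lQ; exists (r *< t).
- move: x; apply: addspan_min.
    by apply: subgroup_preimage;
      [exact: rng_mul_additiver | exact: subgroup_addspan].
  move=> _ [q [p ->]] /=; rewrite rng_mulA lQ; apply: sub_addspan.
  by exists (r *< q), p.
Qed.

Lemma lmulQ_bipart m n q x :
  toeplitz_bipart iota m n x -> toeplitz_bipart iota m.+1 n (iQ q * x).
Proof.
case: m n => [|m] [|n] /=.
- by move=> [s _ <-]; exists (q >* s) => //; rewrite -iQr.
- by move=> [t _ <-]; apply: sub_addspan; exists q, t.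
- by move=> [t _ <-]; exists (tens q t : tpow Q m.+1) => //;
    exact: (tpow_liftS iQB iQl iQr).
- move: x; apply: addspan_min.
    by apply: subgroup_preimage;
      [exact: rng_mul_additiver | exact: subgroup_addspan].
  move=> _ [t [p ->]] /=; rewrite rng_mulA -(tpow_liftS iQB iQl iQr).
  by apply: sub_addspan; exists (tens q t), p.
Qed.

Lemma lmulP_bipart0 n p x :
  toeplitz_bipart iota 0 n x -> toeplitz_bipart iota 0 n.+1 (iP p * x).
Proof.
case: n => [|n] [t _ <-] /=; first by exists (p >* t) => //; rewrite -iPr.
by exists (tens p t : tpow P n.+1) => //; exact: (tpow_liftS iPB iPl iPr).
Qed.

(** The factor [p] contracts with the leftmost factor of [t] to a scalar given by [psi], which then
    acts on what remains. Since [tpow Q m] has [m.+1] factors, [m] of them are left. *)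
Lemma lmulP_tpowQ m p (t : tpow Q m) :
  toeplitz_bipart iota m 0 (iP p * tpow_lift iQ t).
Proof.
case: m t => [|m] t; first by rewrite -rep_psi; eexists.
move: t; apply: tensor_ind => [|q t].
  apply: (@subgroup_preimage _ _ (fun t : tpow Q m.+1 => iP p * tpow_lift iQ t)).
    apply: zmod_morphism_comp; first exact: rng_mul_additiver.
    exact: (tpow_lift_additive iQB iQl iQr (n := m.+1)).
  exact: subgroup_toeplitz_bipart.
have -> : tpow_lift iQ (tens q t : tpow Q m.+1) = iQ q * tpow_lift iQ t.
  exact: (tpow_liftS iQB iQl iQr).
rewrite rng_mulA -rep_psi.
by apply: lmulR_bipart; exists t.
Qed.

Lemma rmulP_bipart m n x (t : tpow P n) :
  toeplitz_bipart iota m 0 x -> toeplitz_bipart iota m n.+1 (x * tpow_lift iP t).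
Proof.
case: m => [|m] [u _ <-]; last by apply: sub_addspan; exists u, t.
by apply: lmulR_bipart; exists t.
Qed.

Lemma lmulP_bipart m n p x :
  toeplitz_bipart iota m.+1 n x -> toeplitz_bipart iota m n (iP p * x).
Proof.
case: n => [[t _ <-]|n]; first exact: lmulP_tpowQ.
move: x; apply: addspan_min.
  by apply: subgroup_preimage;
      [exact: rng_mul_additiver | exact: subgroup_toeplitz_bipart].
move=> _ [q [t ->]] /=; rewrite rng_mulA.
exact/rmulP_bipart/lmulP_tpowQ.
Qed.

(* Left multiplication by a generator of degree [d] maps part [l] into part
   [d + l]; elements with this property form a graded family containing the
   generators, hence all the parts. *)
Lemma toeplitz_partM k l x y : toeplitz_part iota k x ->
  toeplitz_part iota l y -> toeplitz_part iota (k + l) (x * y).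
Proof.
pose Y d := [set x | forall l y,
  toeplitz_part iota l y -> toeplitz_part iota (d + l) (x * y)].
suff partY : toeplitz_part iota k `<=` Y k by move=> /partY; exact.
have lY d z : (forall (m n : nat) y, toeplitz_bipart iota m n y ->
    toeplitz_part iota (d + (m%:Z - n%:Z)) (z * y)) -> Y d z.
  move=> zY l'.
  suff: toeplitz_part iota l' `<=` rng_mul z @^-1` toeplitz_part iota (d + l') by [].
  apply: sum_subgroups_min.
    apply: subgroup_preimage; first exact: rng_mul_additiver.
    exact: subgroup_toeplitz_part.
  by move=> [m n] /= <- u; exact: zY.
apply: toeplitz_part_min => [d|d e u v uY vY l' y' /vY vy|||].
- split=> [l' y' _|u v uY vY l' y' y'P].
    rewrite (zmod_morphism0 (rng_mul_additivel y')).
    by case: (subgroup_toeplitz_part (d + l')).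
  rewrite (rng_mul_additivel y').
  by apply: (proj2 (subgroup_toeplitz_part (d + l'))); [exact: uY | exact: vY].
- by rewrite -rng_mulA -addrA; exact: uY.
- move=> _ [r _ <-]; apply: lY => m n u uP; rewrite add0r.
  exact/(sub_toeplitz_part m n)/lmulR_bipart.
- move=> _ [q _ <-]; apply: lY => m n u uP.
  apply/(sub_toeplitz_part m.+1 n); last exact: lmulQ_bipart.
  by rewrite intS addrA.
(* With no [Q] factor to contract, [p] is prepended and [n] grows; otherwise contraction lowers the
   first index. Both lower the degree by one. *)
- move=> _ [p _ <-]; apply: lY => -[|m] n u uP.
    apply/(sub_toeplitz_part 0 n.+1); last exact: lmulP_bipart0.
    by rewrite intS opprD addrCA.
  apply/(sub_toeplitz_part m n); last exact: lmulP_bipart.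
  by rewrite intS addrA addrA addNr add0r.
Qed.

Lemma rep_R_part : range iR `<=` toeplitz_part iota 0.
Proof. exact: (sub_toeplitz_part 0 0). Qed.

Lemma rep_Q_part : range iQ `<=` toeplitz_part iota 1.
Proof. exact: (sub_toeplitz_part 1 0). Qed.

Lemma rep_P_part : range iP `<=` toeplitz_part iota (-1).
Proof. exact: (sub_toeplitz_part 0 1). Qed.

(** The sum of the parts is a subring containing the generators. *)
Lemma toeplitz_part_full : is_surjective_rep iota ->
  sum_subgroups [set: int] (toeplitz_part iota) = [set: T].
Proof.
move=> gen; apply/seteqP; split=> // x _.
set W := sum_subgroups _ _; have sW : subgroup W.
  by apply: subgroup_sum => i _; exact: subgroup_toeplitz_part.
have pW k : toeplitz_part iota k `<=` W.
  by apply: sub_sum_subgroups => // i _; exact: subgroup_toeplitz_part.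
have : [set: T] x by []; rewrite -gen; apply: smallest_sub.
  split=> // u v uW vW; move: u uW.
  suff: W `<=` rng_mul^~ v @^-1` W by [].
  apply: sum_subgroups_min => [|k _ u uk].
    by apply: subgroup_preimage => //; exact: rng_mul_additivel.
  move: v vW; suff: W `<=` rng_mul u @^-1` W by [].
  apply: sum_subgroups_min => [|l _ v vl].
    by apply: subgroup_preimage => //; exact: rng_mul_additiver.
  by apply: (pW (k + l)); exact: toeplitz_partM.
move=> u [[|]|]; [move/rep_R_part | move/rep_Q_part | move/rep_P_part]; exact: pW.
Qed.

(** * Independence of the parts *)

Lemma shift0_repM : {morph shift T 0 \o iR : r s / r * s}.
Proof. by move=> r s /=; rewrite rng_morphM shiftM. Qed.

(** The relation for [psi] survives the twist because the shifts by -1 and 1 cancel. The definition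
    is transparent so that its components unfold on generators. *)
Definition shift_rep : covariant_rep X (end_rng (int -> int * T)).
Proof.
pose sR := HB.pack_for (rngMorphism R (end_rng (int -> int * T)))
  (shift T 0 \o iR) (isRngMultiplicative.Build _ _ (shift T 0 \o iR) shift0_repM).
refine (@CovariantRep _ X _ (shift T (-1) \o iP) (shift T 1 \o iQ) sR _ _ _ _ _).
- by move=> p r /=; rewrite iPr shiftM.
- by move=> r p /=; rewrite iPl shiftM.
- by move=> q r /=; rewrite iQr shiftM.
- by move=> r q /=; rewrite iQl shiftM.
- by move=> p q /=; rewrite rep_psi shiftM.
Defined.

Lemma toeplitz_part_direct : is_toeplitz iota -> is_direct_sum (toeplitz_part iota).
Proof.
move=> [gen univ]; have [eta [etaR etaQ etaP] _] := univ _ shift_rep.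
have etaE k x : toeplitz_part iota k x -> eta x = shift T k x.
  apply: (toeplitz_part_min (fun k => [set x | eta x = shift T k x])) => //=.
  - move=> d; split=> /= [|u v /= uE vE]; first by rewrite !raddf0.
    by rewrite !raddfB /= uE vE.
  - by move=> d e u v /= uE vE; rewrite rng_morphM uE vE shiftM.
  - by move=> _ [r _ <-]; exact: etaR.
  - by move=> _ [q _ <-]; exact: etaQ.
  - by move=> _ [p _ <-]; exact: etaP.
(* By [etaE], taking the coefficient of index [i] after [eta] is the projection onto part [i]. *)
apply: (direct_sum_proj _ (fun i => coef T i \o eta)) => [k|i k x xk|].
- exact: subgroup_toeplitz_part.
- by rewrite /= (etaE k) // coef_shift.
- exact: toeplitz_part_full.
Qed.

End Toeplitz.

Theorem proposition3p1 (R : rngType) (X : rsystem R)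
    (T : rngType) (iota : covariant_rep X T) (Tiota : is_toeplitz iota) :
  is_Zgrading (toeplitz_part iota) /\
  forall Y : int -> set T,
    is_Zgrading Y ->
    range (rep_R iota) `<=` Y 0 ->
    range (rep_Q iota) `<=` Y 1 ->
    range (rep_P iota) `<=` Y (-1) ->
    forall n : int, Y n = toeplitz_part iota n.
Proof.
have part_dir := toeplitz_part_direct _ _ _ _ Tiota.
split; first by split=> // k l x y; exact: toeplitz_partM.
move=> Y [Y_dir YM] YR YQ YP n;
  rewrite (@direct_sum_sub _ _ Y (toeplitz_part iota)) //.
by apply: toeplitz_part_min => //; case: Y_dir.
Qed.
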